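(* The following statement (the ''MVB conjecture'') is false: for each instance $(l_i,r_i)_{1\le i\le n}$ of Multiple Variable Branching, there exist an index $i$ with $\varphi_i = \min_{1 \le j \le n} \varphi_j$ and a gap $H$ such that for all integer gaps $G > H$, variable $i$ is optimal to branch on at the root node, i.e. $t(G) = 1 + t(G-l_i) + t(G-r_i)$.
   Context: A variable is a pair $(l,r)$ of integers with $1 \le l \le r$. An instance of the Multiple Variable Branching (MVB) problem is a finite nonempty collection of variables $(l_i,r_i)_{1\le i \le n}$, each of which may be branched on arbitrarily many times. A branch-and-bound tree is a vertex-weighted full binary tree, where each internal node is associated with a variable $(l_i,r_i)$ of the instance and, if it has weight $g$, its two children have weights $g+l_i$ and $g+r_i$; the root has weight $0$. The tree closes a gap of $G$ if all leaves have weight at least $G$. The minimum number of nodes $t(G)$ of such a tree closing the integer gap $G$ satisfies $t(G) = 1$ for $G \le 0$ and $t(G) = 1 + \min_{1 \le i \le n}\bigl(t(G-l_i)+t(G-r_i)\bigr)$ for $G>0$. The ratio $\varphi_i$ of the variable $(l_i,r_i)$ is the unique root greater than $1$ of $x^{r_i} - x^{r_i-l_i} - 1$. *)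

(* Defs.v *)
From HB Require Import structures.
From mathcomp Require Import all_boot all_order all_algebra.
From mathcomp Require Import boolp classical_sets reals.
Set Implicit Arguments.
Unset Strict Implicit.
Unset Printing Implicit Defensive.
Import Order.TTheory GRing.Theory Num.Theory.
Local Open Scope ring_scope.

Record variable := MkVariable {
  gain_l : nat;
  gain_r : nat;
  gain_bounds : (1 <= gain_l <= gain_r)%N }.

(* An instance is a nonempty family of variables, [n.+1] being their number;
   repetitions are allowed. *)
Definition instance (n : nat) := 'I_n.+1 -> variable.

Inductive bbtree (n : nat) : Type :=
| Leaf
| Node of 'I_n.+1 & bbtree n & bbtree n.
Arguments Leaf {n}.

Fixpoint nodes n (T : bbtree n) : nat :=
  if T is Node _ T1 T2 then (1 + nodes T1 + nodes T2)%N else 1%N.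

(* The weights are determined by the weight [g] of the root and by the
   branching variables, hence they are computed rather than stored. *)
Fixpoint leaf_weights n (I : instance n) (g : int) (T : bbtree n) : seq int :=
  if T is Node i T1 T2 then
    leaf_weights I (g + (gain_l (I i))%:Z) T1 ++
    leaf_weights I (g + (gain_r (I i))%:Z) T2
  else [:: g].

Definition closes n (I : instance n) (G : int) (T : bbtree n) : bool :=
  all (fun w => G <= w) (leaf_weights I 0 T).

Definition closable n (I : instance n) (G : int) (m : nat) : Prop :=
  exists T : bbtree n, closes I G T /\ nodes T = m.

Lemma ex_closable n (I : instance n) (G : int) :
  exists m, `[< closable I G m >].
Proof.
suff [T HT] : exists T, closes I G T by exists (nodes T); apply/asboolP; exists T.
rewrite /closes; move: 0 => g.
have [k] : exists k : nat, G <= g + k%:Z.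
  by exists `|G - g|%N; rewrite -lerBlDl; exact: lez_abs.
elim: k g => [|k IH] g Hk.
  by exists Leaf; rewrite /= andbT; rewrite addr0 in Hk.
have step d : (0 < d)%N -> G <= g + d%:Z + k%:Z.
  move=> d0; apply: le_trans Hk _.
  by rewrite -addrA lerD2l -PoszD lez_nat -addn1 addnC leq_add2r.
have /andP[l0 lr] := gain_bounds (I ord0).
have [T1 H1] := IH _ (step _ l0).
have [T2 H2] := IH _ (step _ (leq_trans l0 lr)).
by exists (Node ord0 T1 T2); rewrite /= all_cat H1 H2.
Qed.

(* The minimum number of nodes of a tree closing the gap [G]. *)
Definition min_nodes n (I : instance n) (G : int) : nat := ex_minn (ex_closable I G).

Definition ratio_poly (R : realType) (v : variable) : {poly R} :=
  'X^(gain_r v) - 'X^(gain_r v - gain_l v) - 1.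

Lemma ratio_ex_unique (R : realType) (v : variable) :
  exists! x : R, 1 < x /\ root (ratio_poly R v) x.
Proof.
have /andP[l0 lr] := gain_bounds v.
pose l := gain_l v; pose r := gain_r v.
have rE : r = (r - l + l)%N by rewrite subnK.
have pE x : (ratio_poly R v).[x] = x ^+ (r - l) * (x ^+ l - 1) - 1.
  by rewrite /ratio_poly !hornerE mulrBr mulr1 -exprD subnK.
have incr (x y : R) : 1 < x -> x < y ->
    (ratio_poly R v).[x] < (ratio_poly R v).[y].
  move=> x1 xy; rewrite !pE ltrD2r.
  have x0 : 0 < x by exact: lt_trans x1.
  have y0 : 0 < y by exact: lt_trans xy.
  apply: (@le_lt_trans _ _ (y ^+ (r - l) * (x ^+ l - 1))).
    apply: ler_wpM2r; last by apply: lerXn2r; rewrite ?nnegrE ltW.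
    by rewrite subr_ge0 exprn_ege1 // ltW.
  rewrite ltr_pM2l ?exprn_gt0 // ltrD2r.
  by rewrite ltrXn2r ?(ltW x0) // -lt0n.
have [x /andP[x1 x2] rx] : exists2 x : R, 1 < x <= 2 & root (ratio_poly R v) x.
  have p1 : (ratio_poly R v).[1] = -1 by rewrite pE !expr1n subrr mulr0 sub0r.
  have p2 : 0 <= (ratio_poly R v).[2].
    have h2 k : 1 <= (2 : R) ^+ k by rewrite exprn_ege1 // ler1n.
    rewrite pE subr_ge0; apply: le_trans (h2 (r - l)%N) _.
    rewrite ler_peMr ?exprn_ge0 // lerBrDr -[1 + 1]/(2 : R).
    by rewrite -[leLHS]expr1 ler_weXn2l // ler1n.
  have [|x /andP[a b] rx] := @poly_ivt R (ratio_poly R v) 1 2 (ler1n _ _).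
    by rewrite p1 p2 lerN10.
  exists x => //; rewrite b andbT lt_neqAle a andbT.
  apply/eqP => x1; move: rx; rewrite -x1 rootE p1.
  by rewrite oppr_eq0 oner_eq0.
exists x; split=> // y [y1 /rootP ry]; move/rootP: rx => rx.
by case: (ltgtP x y) => // [/(incr _ _ x1)|/(incr _ _ y1)]; rewrite rx ry ltxx.
Qed.

(* By [ratio_ex_unique], the default value [0] is never used. *)
Definition var_ratio (R : realType) (v : variable) : R :=
  xget 0 [set x : R | 1 < x /\ root (ratio_poly R v) x]%classic.

(* Main.v *)
Require Import Defs.
From mathcomp Require Import all_boot all_order all_algebra.
From mathcomp Require Import boolp classical_sets reals.
From mathcomp Require Import ring lra zify.
Import Order.TTheory GRing.Theory Num.Theory.
Local Open Scope ring_scope.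

(** The counterexample has the two variables (3, 3) and (1, 6). Write
    T(G) = t(G) + 1, so that T(G) <= T(G - l) + T(G - r) for both variables.

    The ratio of (3, 3) is the cube root of 2, and that of (1, 6) is strictly
    larger ([ratio_3_3_lt_ratio_1_6]). If the conjecture held, (3, 3) would be
    optimal for all large gaps, hence T would eventually double every three
    steps. But gaps that are not multiples of 3 are wasteful for (3, 3) alone:
    branching on (1, 6) at G = 3k + 1 leads to the gap 3k, where T is at most
    2^(k+1), and to the gap 3(k - 2) + 1, which is in the class of G mod 3.
    This gives u_k <= 2^(k+1) + u_(k-2) for u_k = T(3k + 1). For b_k = u_k / 2^k
    this reads b_k <= 2 + b_(k-2) / 4, a contraction with fixed point 8/3.
    Hence b_k cannot be eventually constant, unless its eventual value is at
    most 8/3. This is excluded by the strict bound b_k > 8/3.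

    The bound b_k >= 8/3 comes from a potential on gaps, [potential], that is
    bounded by the sum of its values at the two children for either variable.
    It is strict because 3 u_k = 2^(k+3) is impossible modulo 3. *)

(** * The dynamic programming recursion *)

Lemma leaf_weights_shift {n} (I : instance n) (g h : int) (T : bbtree n) :
  leaf_weights I (g + h) T = [seq w + h | w <- leaf_weights I g T].
Proof.
elim: T g => [//|i T1 IH1 T2 IH2] g /=.
by rewrite map_cat -IH1 -IH2 ![g + h + _]addrAC.
Qed.

Lemma closes_leaf {n} (I : instance n) (G : int) : closes I G Leaf = (G <= 0).
Proof. by rewrite /closes /= andbT. Qed.

Lemma closes_node {n} (I : instance n) (G : int) i (T1 T2 : bbtree n) :
  closes I G (Node i T1 T2) =
    closes I (G - (gain_l (I i))%:Z) T1 && closes I (G - (gain_r (I i))%:Z) T2.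
Proof.
rewrite /closes /= all_cat !leaf_weights_shift !all_map.
by congr (_ && _); apply: eq_all => w /=; rewrite lerBlDr.
Qed.

Lemma min_nodes_le {n} (I : instance n) (G : int) (T : bbtree n) :
  closes I G T -> (min_nodes I G <= nodes T)%N.
Proof.
move=> cT; rewrite /min_nodes; case: ex_minnP => m _; apply.
by apply/asboolP; exists T.
Qed.

Lemma min_nodes_attained {n} (I : instance n) (G : int) :
  exists2 T : bbtree n, closes I G T & nodes T = min_nodes I G.
Proof.
by rewrite /min_nodes; case: ex_minnP => m /asboolP[T [cT nT]] _; exists T.
Qed.

Lemma min_nodes_gap_le0 {n} (I : instance n) (G : int) :
  G <= 0 -> (min_nodes I G <= 1)%N.
Proof. by move=> G0; apply: (@min_nodes_le _ I G Leaf); rewrite closes_leaf. Qed.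

Lemma min_nodes_branch {n} (I : instance n) (G : int) i :
  (min_nodes I G <= 1 + min_nodes I (G - (gain_l (I i))%:Z)
                    + min_nodes I (G - (gain_r (I i))%:Z))%N.
Proof.
have [T1 c1 <-] := min_nodes_attained I (G - (gain_l (I i))%:Z).
have [T2 c2 <-] := min_nodes_attained I (G - (gain_r (I i))%:Z).
by apply: (@min_nodes_le _ I G (Node i T1 T2)); rewrite closes_node c1.
Qed.

(** * The two variables and their ratios *)

Definition var_3_3 : variable := @MkVariable 3 3 isT.
Definition var_1_6 : variable := @MkVariable 1 6 isT.

Definition counterexample : instance 1 :=
  fun i => if i == ord0 then var_3_3 else var_1_6.

Lemma var_ratioP (R : realType) (v : variable) (x := var_ratio R v) :
  1 < x /\ x ^+ gain_r v = x ^+ (gain_r v - gain_l v) + 1.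
Proof.
have [y [yP _]] := ratio_ex_unique R v.
have [] : 1 < x /\ root (ratio_poly R v) x.
  by apply: (@xgetPex _ 0 [set z : R | 1 < z /\ root (ratio_poly R v) z]%classic);
    exists y.
move=> x1 /rootP; rewrite /ratio_poly !hornerE => /eqP.
by rewrite -addrA -opprD subr_eq0 => /eqP.
Qed.

(** If the ratio x of (1, 6) were at most the ratio y of (3, 3), where y^3 = 2,
    then 1 = x^5 (x - 1) <= y^5 (y - 1) = 4 - 2 y^2, hence y^2 <= 3/2 and
    4 = (y^2)^3 <= 27/8. *)
Lemma ratio_3_3_lt_ratio_1_6 (R : realType) :
  var_ratio R var_3_3 < var_ratio R var_1_6.
Proof.
have [] := var_ratioP R var_3_3; have [] := var_ratioP R var_1_6.
set x := var_ratio R var_1_6; set y := var_ratio R var_3_3.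
rewrite /= subnn expr0 subn1 /= => x1 rx y1 y3.
rewrite ltNge; apply/negP => xy.
have mono : x ^+ 5 * (x - 1) <= y ^+ 5 * (y - 1).
  apply: ler_pM; [by apply: exprn_ge0; lra|lra| |lra].
  by apply: lerXn2r xy; rewrite nnegrE; lra.
have y5 : y ^+ 5 * (y - 1) = 4 - 2 * y ^+ 2.
  have -> : y ^+ 5 * (y - 1) = y ^+ 3 * y ^+ 3 - y ^+ 3 * y ^+ 2 by ring.
  by rewrite y3; ring.
have x5 : x ^+ 5 * (x - 1) = 1.
  have -> : x ^+ 5 * (x - 1) = x ^+ 6 - x ^+ 5 by ring.
  by rewrite rx; ring.
have y2 : y ^+ 2 <= 3 / 2 by lra.
have : (y ^+ 2) ^+ 3 <= (3 / 2) ^+ 3.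
  by apply: lerXn2r y2; rewrite nnegrE; [apply: exprn_ge0; lra|lra].
have -> : (y ^+ 2) ^+ 3 = y ^+ 3 * y ^+ 3 by ring.
by rewrite y3; lra.
Qed.

(** * Lower bound by a potential *)

(** The values y at 1 and z at 2, relative to 6 at 0, are constrained by the
    branching inequality of (1, 6) far from 0: the gaps 1, 2, 0 mod 3 require
    y <= 6 + y / 4, z <= y + z / 4 and 6 <= z / 2 + 6 / 4 respectively. The
    largest y is 8, three times the fixed point 8/3, and it allows z from 9 to
    32/3. *)
Fixpoint pos_potential (d : nat) : nat :=
  match d with
  | 0 => 6
  | 1 => 8
  | 2 => 9
  | d'.+3 => 2 * pos_potential d'
  end.

(** A closed gap costs a single leaf, for which 3 (t + 1) = 6. *)
Definition potential (G : int) : nat :=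
  if G is Posz d then pos_potential d else 6.

Lemma potentialS3 (d : nat) : potential d.+3 = (2 * potential d)%N.
Proof. by []. Qed.

Lemma potential_gap_le0 (G : int) : G <= 0 -> potential G = 6.
Proof. by case: G => [[|d]|d]. Qed.

Lemma potential_branch_3_3 (G : int) :
  (potential G <= potential (G - 3) + potential (G - 3))%N.
Proof.
case: G => [[|[|[|d]]]|d] //.
have -> : d.+3%:Z - 3 = d by lia.
by rewrite potentialS3 mul2n addnn.
Qed.

Lemma potential_branch_1_6 (G : int) :
  (potential G <= potential (G - 1) + potential (G - 6))%N.
Proof.
case: G => [d|d].
  (* from the gap 9 on, all three terms double every three steps *)
  have [m] := ubnP d; elim: m d => [//|m IH] d dm.
  have [d9|] := ltnP d 9.
    by do 9![case: d dm d9 => [//|d] dm d9].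
  case: d dm => [//|[//|[//|d]]] dm d9.
  have -> : d.+3%:Z - 1 = (d - 1).+3%N by lia.
  have -> : d.+3%:Z - 6 = (d - 6).+3%N by lia.
  rewrite !potentialS3 -mulnDr leq_pmul2l //.
  have -> : (d - 1)%N = d%:Z - 1 :> int by lia.
  have -> : (d - 6)%N = d%:Z - 6 :> int by lia.
  by apply: IH; lia.
have -> : Negz d - 1 = Negz d.+1 by lia.
have -> : Negz d - 6 = Negz (d + 6) by lia.
by [].
Qed.

Lemma potential_le_nodes (G : int) (T : bbtree 1) :
  closes counterexample G T -> (potential G <= 3 * (nodes T).+1)%N.
Proof.
elim: T G => [|i T1 IH1 T2 IH2] G.
  by rewrite closes_leaf => /potential_gap_le0 ->.
rewrite closes_node => /andP[/IH1 + /IH2].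
have : (potential G <= potential (G - (gain_l (counterexample i))%:Z)
                     + potential (G - (gain_r (counterexample i))%:Z))%N.
  rewrite /counterexample; case: ifP => _.
    exact: potential_branch_3_3.
  exact: potential_branch_1_6.
by rewrite /=; lia.
Qed.

Lemma potential_3k1 (k : nat) : potential (3 * k + 1)%N = (8 * 2 ^ k)%N.
Proof.
elim: k => [//|k IH].
have -> : (3 * k.+1 + 1 = (3 * k + 1).+3)%N by lia.
by rewrite potentialS3 IH expnS mulnCA.
Qed.

(** The potential gives the weak inequality; equality would make 3 divide a
    power of 2. *)
Lemma min_nodes_3k1_gt (k : nat) :
  (8 * 2 ^ k < 3 * (min_nodes counterexample (3 * k + 1)%N).+1)%N.
Proof.
have [T /potential_le_nodes + <-] :=
  min_nodes_attained counterexample (3 * k + 1)%N.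
rewrite potential_3k1 leq_eqVlt => /orP[/eqP E|//].
have : (3 %| 8 * 2 ^ k)%N by rewrite E dvdn_mulr.
by rewrite -(expnD 2 3 k) Euclid_dvdX.
Qed.

(** * Upper bounds and the contradiction *)

Lemma min_nodes_3k_le (k : nat) :
  ((min_nodes counterexample (3 * k)%N).+1 <= 2 ^ k.+1)%N.
Proof.
elim: k => [|k IH]; first by rewrite ltnS min_nodes_gap_le0.
have := min_nodes_branch counterexample (3 * k.+1)%N ord0 => /=.
have -> : (3 * k.+1)%N%:Z - 3 = (3 * k)%N by lia.
by rewrite expnS; lia.
Qed.

Lemma min_nodes_3k7_le (k : nat) :
  ((min_nodes counterexample (3 * k + 7)%N).+1
   <= 8 * 2 ^ k + (min_nodes counterexample (3 * k + 1)%N).+1)%N.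
Proof.
have := min_nodes_branch counterexample (3 * k + 7)%N ord_max => /=.
have -> : (3 * k + 7)%N%:Z - 1 = (3 * k.+2)%N by lia.
have -> : (3 * k + 7)%N%:Z - 6 = (3 * k + 1)%N by lia.
by have := min_nodes_3k_le k.+2; rewrite !expnS; lia.
Qed.

Theorem theorem2 (R : realType) :
  ~ (forall (n : nat) (I : instance n),
       exists i : 'I_n.+1,
         (forall j : 'I_n.+1, var_ratio R (I i) <= var_ratio R (I j)) /\
         exists H : int, forall G : int, H < G ->
           min_nodes I G = (1 + min_nodes I (G - (gain_l (I i))%:Z)
                      + min_nodes I (G - (gain_r (I i))%:Z))%N).
Proof.
move=> /(_ 1%N counterexample)[i [imin [H optimal]]].
have Ii : counterexample i = var_3_3.
  rewrite /counterexample; case: ifP => // i0.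
  have := imin ord0; rewrite /counterexample i0 /=.
  by rewrite leNgt ratio_3_3_lt_ratio_1_6.
pose k := `|H|%N.
have opt4 := optimal (3 * k + 4)%N ltac:(lia).
have opt7 := optimal (3 * k + 7)%N ltac:(lia).
rewrite Ii /= in opt4 opt7.
have E4 : (3 * k + 4)%N%:Z - 3 = (3 * k + 1)%N by lia.
have E7 : (3 * k + 7)%N%:Z - 3 = (3 * k + 4)%N by lia.
rewrite E4 in opt4; rewrite E7 in opt7.
(* doubling twice, u_(k+2) = 4 u_k, which forces 3 u_k <= 2^(k+3) *)
by have := min_nodes_3k1_gt k; have := min_nodes_3k7_le k; lia.
Qed.
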